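(* Let $A,B$ be finite sets, $\mathcal{H}:B^A\to\{0,1\}$, $\mathcal{A}\subseteq\mathcal{H}^{-1}(0)$, $\mathcal{B}\subseteq\mathcal{H}^{-1}(1)$, and consider the problem of computing $\mathcal{H}(F^* )$ given oracle access to an unknown $F^*\in\mathcal{A}\cup\mathcal{B}$. Let $T$ be the expected number of queries required in the worst case by the best randomized algorithm to succeed with probability $9/10$. If the original relational adversary method provides a lower bound of $T\ge\Lambda$, then the variant relational adversary method can prove a lower bound of $T\ge\Lambda/40$. (Both methods, and what it means for them to provide a bound, are specified in the context.)
   Context: Original relational adversary method (Aaronson): choose a non-zero function $r:\mathcal{A}\times\mathcal{B}\to\mathbb{R}_{\ge 0}$. For $F_1\in\mathcal{A}$, $F_2\in\mathcal{B}$, $a\in A$ set $$\theta(F_1,a)=\frac{\sum_{F_3\in\mathcal{B}:\,F_1(a)\ne F_3(a)}r(F_1,F_3)}{\sum_{F_3\in\mathcal{B}}r(F_1,F_3)},\qquad \theta(F_2,a)=\frac{\sum_{F_3\in\mathcal{A}:\,F_2(a)\ne F_3(a)}r(F_3,F_2)}{\sum_{F_3\in\mathcal{A}}r(F_3,F_2)}$$ whenever the denominators are nonzero, and $$v_{\min}=\max_{\substack{F_1\in\mathcal{A},\,F_2\in\mathcal{B},\,a\in A:\\ r(F_1,F_2)>0,\ F_1(a)\ne F_2(a)}}\min\{\theta(F_1,a),\theta(F_2,a)\}.$$ The method provides the lower bound $\Lambda=1/(5v_{\min})$ on $T$; ''the method provides a lower bound of $T\ge\Lambda$'' means that some such $r$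 has $1/(5v_{\min})=\Lambda$. Variant relational adversary method: let $\mathcal{X}=\mathcal{A}\cup\mathcal{B}$ and choose a non-zero symmetric function $r:\mathcal{X}\times\mathcal{X}\to\mathbb{R}_{\ge 0}$ with $r(F_1,F_2)=0$ whenever $\mathcal{H}(F_1)=\mathcal{H}(F_2)$. For $\mathcal{Z}\subseteq\mathcal{X}$ let $M(\mathcal{Z})=\sum_{F_1\in\mathcal{Z}}\sum_{F_2\in\mathcal{X}}r(F_1,F_2)$ and $q(\mathcal{Z})=\max_{a\in A}\sum_{F_1\in\mathcal{Z}}\sum_{F_2\in\mathcal{Z}}r(F_1,F_2)\mathbf{1}_{\{F_1(a)\ne F_2(a)\}}$. If some $\mathcal{Z}\subseteq\mathcal{X}$ has $q(\mathcal{Z})>0$, the method gives the lower bound $\min_{\mathcal{Z}\subseteq\mathcal{X}:\,q(\mathcal{Z})>0}\frac{M(\mathcal{Z})}{100\,q(\mathcal{Z})}$ on $T$; ''the method can prove $T\ge\Lambda'$'' means that some such $r$ (with some $q(\mathcal{Z})>0$) makes this quantity at least $\Lambda'$. *)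

(* Defs.v *)
From HB Require Import structures.
From mathcomp Require Import all_boot all_order all_algebra.
From mathcomp Require Import reals.

Set Implicit Arguments.
Unset Strict Implicit.
Unset Printing Implicit Defensive.

Import Order.TTheory GRing.Theory Num.Theory.
Local Open Scope ring_scope.

(* The inputs are the finite functions {ffun A -> B}. The sets
   calA, calB of inputs stand for the script letters, and a weight on calA x calB
   (resp. on X x X) is a total function of which only the values on
   calA x calB (resp. on X x X) are ever constrained or used. *)

Section OriginalMethod.
Variables (R : realType) (A B : finType).
Local Notation input := {ffun A -> B}.
Variables (calA calB : {set input}) (r : input -> input -> R).

Definition original_weight : Prop :=
  {in calA & calB, forall F1 F2, 0 <= r F1 F2} /\
  (exists F1 F2, [/\ F1 \in calA, F2 \in calB & r F1 F2 != 0]).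

(* When the denominator vanishes these take the value 0; this never occurs in
   vmin, where r F1 F2 > 0. *)
Definition thetaA (F1 : input) (a : A) : R :=
  (\sum_(F3 in calB | F1 a != F3 a) r F1 F3) / (\sum_(F3 in calB) r F1 F3).

Definition thetaB (F2 : input) (a : A) : R :=
  (\sum_(F3 in calA | F2 a != F3 a) r F3 F2) / (\sum_(F3 in calA) r F3 F2).

(* The seed 0 does not affect the maximum: the terms are nonnegative, and for a
   weight r supported on pairs of distinct inputs there is at least one term. *)
Definition vmin : R :=
  \big[Num.max/0]_(x : input * input * A |
      let: (F1, F2, a) := x in
      [&& F1 \in calA, F2 \in calB, 0 < r F1 F2 & F1 a != F2 a])
    let: (F1, F2, a) := x in Num.min (thetaA F1 a) (thetaB F2 a).

End OriginalMethod.

Definition original_method_provides (R : realType) (A B : finType)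
    (calA calB : {set {ffun A -> B}}) (L : R) : Prop :=
  exists r : {ffun A -> B} -> {ffun A -> B} -> R,
    original_weight calA calB r /\ 1 / (5 * vmin calA calB r) = L.

Section VariantMethod.
Variables (R : realType) (A B : finType).
Local Notation input := {ffun A -> B}.
Variables (H : input -> bool) (X : {set input}) (r : input -> input -> R).

Definition variant_weight : Prop :=
  [/\ {in X &, forall F1 F2, 0 <= r F1 F2},
      {in X &, forall F1 F2, r F1 F2 = r F2 F1},
      {in X &, forall F1 F2, H F1 = H F2 -> r F1 F2 = 0} &
      exists F1 F2, [/\ F1 \in X, F2 \in X & r F1 F2 != 0]].

Definition M (Z : {set input}) : R := \sum_(F1 in Z) \sum_(F2 in X) r F1 F2.

(* The seed 0 does not affect the maximum: the terms are nonnegative for Z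
   included in X, and A is nonempty as soon as H is not constant. *)
Definition q (Z : {set input}) : R :=
  \big[Num.max/0]_(a : A)
    \sum_(F1 in Z) \sum_(F2 in Z) r F1 F2 * (F1 a != F2 a)%:R.

Definition ratio (Z : {set input}) : R := M Z / (100 * q Z).

(* The minimum of ratio over the Z included in X with q Z > 0; Z0 is any such
   set, and only seeds the iterated minimum. *)
Definition variant_bound (Z0 : {set input}) : R :=
  \big[Num.min/ratio Z0]_(Z : {set input} | (Z \subset X) && (0 < q Z)) ratio Z.

End VariantMethod.

Definition variant_method_proves (R : realType) (A B : finType)
    (H : {ffun A -> B} -> bool) (calA calB : {set {ffun A -> B}})
    (L : R) : Prop :=
  let X := calA :|: calB in
  exists r : {ffun A -> B} -> {ffun A -> B} -> R,
    variant_weight H X r /\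
    exists Z0 : {set {ffun A -> B}},
      [/\ Z0 \subset X, 0 < q r Z0 & L <= variant_bound X r Z0].

(* Main.v *)
Require Import Defs.
From HB Require Import structures.
From mathcomp Require Import all_boot all_order all_algebra.
From mathcomp Require Import reals ring.

Set Implicit Arguments.
Unset Strict Implicit.
Unset Printing Implicit Defensive.

Import Order.TTheory GRing.Theory Num.Theory.
Local Open Scope ring_scope.

(** Use the symmetrization of [r] as the weight of the variant method, and fix
    [Z] and [a]. Whenever [r F1 F2 > 0] and [F1 a != F2 a], one of
    [theta(F1, a)], [theta(F2, a)] is at most [vmin]; charge the pair to the
    corresponding endpoint. The pairs charged to an endpoint [F] weigh at most
    [vmin] times the total weight of [F], so that the pairs of [Z] separated by
    [a] weigh at most [vmin * M Z]. Each of them is counted twice in [q Z],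
    hence [q Z <= 2 * vmin * M Z]. *)

Lemma ffun_neq (A : finType) (B : eqType) (F G : {ffun A -> B}) :
  F != G -> exists a, F a != G a.
Proof.
move=> neqFG; apply/existsP; apply: contraNT neqFG => /existsPn eqFG.
by apply/eqP/ffunP => a; apply/eqP; have := eqFG a; rewrite negbK.
Qed.

Section RestrictedWeight.
Variables (R : realType) (A B : finType).
Local Notation input := {ffun A -> B}.
Implicit Types (U V Z X : {set input}) (r : input -> input -> R).

(** The weight [r] is only constrained on [U] times [V]; extending it by zero makes it nonnegative
    everywhere, so sums may range over an arbitrary [Z]. *)
Definition restrict_weight U V r (F G : input) : R :=
  if (F \in U) && (G \in V) then r F G else 0.

Definition sym_weight U V r (F G : input) : R :=
  restrict_weight U V r F G + restrict_weight U V r G F.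

Lemma restrict_weight_ge0 U V r F G :
  {in U & V, forall F1 F2, 0 <= r F1 F2} -> 0 <= restrict_weight U V r F G.
Proof.
by move=> r_ge0; rewrite /restrict_weight; case: ifP => // /andP[]; exact: r_ge0.
Qed.

(** Transposing the weight turns [thetaB U r] into a [thetaA], so bounds for first endpoints also
    serve second endpoints. *)
Lemma restrict_weightC U V r F G :
  restrict_weight U V r F G = restrict_weight V U (fun x y => r y x) G F.
Proof. by rewrite /restrict_weight andbC. Qed.

Lemma thetaA_sum_le U V r (v : R) F a :
  {in U & V, forall F1 F2, 0 <= r F1 F2} -> F \in U -> thetaA V r F a <= v ->
  \sum_(G in V | F a != G a) r F G <= v * \sum_(G in V) r F G.
Proof.
move=> r_ge0 FU; rewrite /thetaA.
have num_le : \sum_(G in V | F a != G a) r F G <= \sum_(G in V) r F G.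
  rewrite [leRHS](bigID (fun G : input => F a != G a)) /= lerDl.
  by apply: sumr_ge0 => G /andP[GV _]; exact: r_ge0.
have : 0 <= \sum_(G in V) r F G by apply: sumr_ge0 => G GV; exact: r_ge0.
(* If the denominator is zero, [thetaA] is 0 by convention and its bound says nothing; but the
   numerator is at most the denominator, so it vanishes too. *)
rewrite le_eqVlt => /predU1P[den0 _|den_gt0]; last by rewrite ler_pdivrMr.
by move: num_le; rewrite -den0 mulr0.
Qed.

(** Whether [F] is charged does not depend on [G], so the indicator factors out; when it is 1, the
    bound on [thetaA] applies. *)
Lemma charged_sum_le U V X Z r (v : R) F a :
  {in U & V, forall F1 F2, 0 <= r F1 F2} -> 0 <= v -> V \subset X ->
  \sum_(G in Z) restrict_weight U V r F G * (F a != G a)%:R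
     * (thetaA V r F a <= v)%R%:R
  <= v * \sum_(G in X) restrict_weight U V r F G.
Proof.
move=> r_ge0 v_ge0 VX; have s_ge0 G := restrict_weight_ge0 F G r_ge0.
have rhs_ge0 : 0 <= v * \sum_(G in X) restrict_weight U V r F G.
  by rewrite mulr_ge0 ?sumr_ge0.
rewrite -big_distrl /=.
have [theta_le|_] := boolP (thetaA V r F a <= v); last by rewrite mulr0.
rewrite mulr1.
have [FU|FU] := boolP (F \in U); last first.
  by rewrite big1 // => G _; rewrite /restrict_weight (negbTE FU) mul0r.
(* Terms with [G] outside [V] are zero, and those in [V] but outside [Z] can only increase the
   sum. *)
apply: (@le_trans _ _ (\sum_(G in V | F a != G a) r F G)).
  rewrite big_mkcond [leRHS]big_mkcond /=; apply: ler_sum => G _.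
  rewrite /restrict_weight FU /=.
  case: (boolP (G \in V)) => [GV|_]; last by rewrite mul0r if_same.
  have rFG := r_ge0 _ _ FU GV.
  by case: (F a != G a); rewrite ?mulr1 ?mulr0 ?if_same //; case: ifP.
apply: le_trans (thetaA_sum_le r_ge0 FU theta_le) _.
rewrite ler_wpM2l // big_mkcond [leRHS]big_mkcond /=; apply: ler_sum => G _.
case: ifP => [GV|_]; last by case: ifP.
by rewrite (subsetP VX) // /restrict_weight FU GV.
Qed.

Lemma min_theta_le_vmin U V r F G a :
  F \in U -> G \in V -> 0 < r F G -> F a != G a ->
  Num.min (thetaA V r F a) (thetaB U r G a) <= vmin U V r.
Proof.
move=> FU GV rFG neq.
have := @le_bigmax_cond _ R _ 0 (F, G, a)
  (fun x => let: (F1, F2, b) := x in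
     [&& F1 \in U, F2 \in V, 0 < r F1 F2 & F1 b != F2 b])
  (fun x => let: (F1, F2, b) := x in Num.min (thetaA V r F1 b) (thetaB U r F2 b)).
by apply; apply/and4P.
Qed.

Lemma thetaA_gt0 U V r F G a :
  {in U & V, forall F1 F2, 0 <= r F1 F2} ->
  F \in U -> G \in V -> 0 < r F G -> F a != G a -> 0 < thetaA V r F a.
Proof.
move=> r_ge0 FU GV rFG neq; rewrite divr_gt0 //.
  rewrite (bigD1 G) /= ?GV ?neq // ltr_pwDl // sumr_ge0 // => K.
  by move=> /andP[/andP[KV _] _]; exact: r_ge0.
by rewrite (bigD1 G) //= ltr_pwDl // sumr_ge0 // => K /andP[KV _]; exact: r_ge0.
Qed.

Lemma vmin_ge0 U V r : 0 <= vmin U V r.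
Proof. exact: bigmax_ge_id. Qed.

Lemma vmin_gt0 U V r F G a :
  {in U & V, forall F1 F2, 0 <= r F1 F2} ->
  F \in U -> G \in V -> 0 < r F G -> F a != G a -> 0 < vmin U V r.
Proof.
move=> r_ge0 FU GV rFG neq.
apply: lt_le_trans (min_theta_le_vmin FU GV rFG neq).
rewrite lt_min (thetaA_gt0 r_ge0 FU GV) //=.
by apply: (@thetaA_gt0 V U (fun x y => r y x) G F) => //;
  [move=> x y xV yU; exact: r_ge0 | rewrite eq_sym].
Qed.

Lemma separated_sum_le U V Z r a :
  {in U & V, forall F1 F2, 0 <= r F1 F2} ->
  \sum_(F in Z) \sum_(G in Z) restrict_weight U V r F G * (F a != G a)%:R
  <= vmin U V r * M (U :|: V) (sym_weight U V r) Z.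
Proof.
move=> r_ge0; set v := vmin U V r; set s := restrict_weight U V r.
have rT_ge0 : {in V & U, forall F1 F2, 0 <= r F2 F1}.
  by move=> x y xV yU; exact: r_ge0.
(* Only an inequality, since both endpoints may be charged for the same pair. *)
have charge F G : s F G * (F a != G a)%:R <=
    s F G * (F a != G a)%:R * (thetaA V r F a <= v)%R%:R +
    s F G * (F a != G a)%:R * (thetaB U r G a <= v)%R%:R.
  rewrite /s /restrict_weight; case: ifP => [/andP[FU GV]|_]; last first.
    by rewrite !mul0r addr0.
  have [neq|_] := boolP (F a != G a); last by rewrite !(mulr0, mul0r) addr0.
  have := r_ge0 _ _ FU GV; rewrite le_eqVlt => /predU1P[<-|rFG].
    by rewrite !mul0r addr0.
  have := min_theta_le_vmin FU GV rFG neq; rewrite ge_min -/v.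
  by case: (_ <= v) => [_|/= ->]; rewrite !(mulr1, mulr0) ?add0r // lerDl;
    case: (_ <= v); rewrite ?mulr1 ?mulr0 // ltW.
apply: (@le_trans _ _ (\sum_(F in Z) \sum_(G in Z)
    (s F G * (F a != G a)%:R * (thetaA V r F a <= v)%R%:R +
     s F G * (F a != G a)%:R * (thetaB U r G a <= v)%R%:R))).
  by apply: ler_sum => F _; apply: ler_sum => G _; exact: charge.
under eq_bigr do rewrite big_split /=.
(* After the exchange the outer variable is the charged endpoint in both sums, so they compare with
   [M] one endpoint at a time; the two halves of [sym_weight] bound the two kinds of charge. *)
rewrite big_split /= [X in _ + X <= _]exchange_big /= -big_split /=.
rewrite /M mulr_sumr; apply: ler_sum => F _.
rewrite big_split /= mulrDr lerD //.
  by apply: charged_sum_le (subsetUr _ _) => //; exact: vmin_ge0.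
under eq_bigr do rewrite /s restrict_weightC eq_sym.
under [X in _ <= _ * X]eq_bigr do rewrite restrict_weightC.
by apply: charged_sum_le (subsetUl _ _) => //; exact: vmin_ge0.
Qed.

Lemma q_sym_weight_le U V Z r :
  {in U & V, forall F1 F2, 0 <= r F1 F2} ->
  q (sym_weight U V r) Z
  <= 2 * (vmin U V r * M (U :|: V) (sym_weight U V r) Z).
Proof.
move=> r_ge0; apply: bigmax_le => [|a _].
  rewrite mulr_ge0 // mulr_ge0 ?vmin_ge0 // !sumr_ge0 // => F _.
  by rewrite sumr_ge0 // => G _; rewrite addr_ge0 ?restrict_weight_ge0.
have -> : \sum_(F in Z) \sum_(G in Z) sym_weight U V r F G * (F a != G a)%:R
    = 2 * \sum_(F in Z) \sum_(G in Z)
            restrict_weight U V r F G * (F a != G a)%:R.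
  under eq_bigr => F _.
    under eq_bigr do rewrite /sym_weight mulrDl.
    rewrite big_split /=; over.
  (* Separation by [a] is symmetric, so swapping the variables identifies the two halves of
     [sym_weight]. *)
  rewrite big_split /= [X in _ + X]exchange_big /= mulr_natl mulr2n.
  congr (_ + _); apply: eq_bigr => F _; apply: eq_bigr => G _.
  by rewrite eq_sym.
by rewrite ler_wpM2l // separated_sum_le.
Qed.

(** Makes [U :|: V] an admissible set in the minimum of the variant method. *)
Lemma q_sym_weight_gt0 U V r F G :
  {in U & V, forall F1 F2, 0 <= r F1 F2} ->
  F \in U -> G \in V -> 0 < r F G -> F != G ->
  0 < q (sym_weight U V r) (U :|: V).
Proof.
move=> r_ge0 FU GV rFG neqFG.
have [a neq] := ffun_neq neqFG.
apply: lt_le_trans (le_bigmax_cond 0 _ (erefl : xpredT a)).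
have s_ge0 F' G' : 0 <= sym_weight U V r F' G' * (F' a != G' a)%:R.
  by rewrite mulr_ge0 // addr_ge0 ?restrict_weight_ge0.
rewrite (bigD1 F) /= ?inE ?FU // ltr_pwDl ?sumr_ge0 // => [|K _]; last first.
  by rewrite sumr_ge0.
rewrite (bigD1 G) /= ?inE ?GV ?orbT // ltr_pwDl ?sumr_ge0 // neq mulr1.
by rewrite ltr_pwDl ?restrict_weight_ge0 // /restrict_weight FU GV.
Qed.

End RestrictedWeight.

Theorem proposition1 (R : realType) (A B : finType)
    (H : {ffun A -> B} -> bool) (calA calB : {set {ffun A -> B}})
    (HcalA : calA \subset [set F | H F == false])
    (HcalB : calB \subset [set F | H F == true])
    (L : R) :
  original_method_provides calA calB L ->
  variant_method_proves H calA calB (L / 40).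
Proof.
move=> [r [[r_ge0 [F [G [FA GB rFG_neq0]]]] <-]].
have HA K : K \in calA -> H K = false.
  by move/(subsetP HcalA); rewrite inE => /eqP.
have HB K : K \in calB -> H K = true.
  by move/(subsetP HcalB); rewrite inE => /eqP.
have rFG : 0 < r F G by rewrite lt_def rFG_neq0 r_ge0.
have neqFG : F != G by apply/eqP => eqFG; move: (HA _ FA); rewrite eqFG HB.
have q_gt0 := q_sym_weight_gt0 r_ge0 FA GB rFG neqFG.
have v_gt0 : 0 < vmin calA calB r.
  have [a neq] := ffun_neq neqFG.
  exact: vmin_gt0 r_ge0 FA GB rFG neq.
exists (sym_weight calA calB r); split.
  split.
  - by move=> x y _ _; rewrite addr_ge0 ?restrict_weight_ge0.
  - by move=> x y _ _; rewrite /sym_weight addrC.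
  - move=> x y _ _ eqH; rewrite /sym_weight /restrict_weight.
    case: ifP => [/andP[/HA + /HB]|_]; first by rewrite eqH => ->.
    case: ifP => [/andP[/HA + /HB]|_]; first by rewrite -eqH => ->.
    by rewrite addr0.
  - exists F, G; rewrite !inE FA GB orbT; split=> //.
    by rewrite gt_eqF // ltr_pwDl ?restrict_weight_ge0 // /restrict_weight FA GB.
exists (calA :|: calB); split=> //.
have ratio_ge Z : 0 < q (sym_weight calA calB r) Z ->
    1 / (5 * vmin calA calB r) / 40
    <= Defs.ratio (calA :|: calB) (sym_weight calA calB r) Z.
  move=> qZ_gt0; rewrite /Defs.ratio ler_pdivlMr ?mulr_gt0 //.
  (* The constant 40 is fixed here: 5 * 40 = 2 * 100, where 2 comes from the double counting in
     [q]. *)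
  have -> : 1 / (5 * vmin calA calB r) / 40 * (100 * q (sym_weight calA calB r) Z)
      = q (sym_weight calA calB r) Z / (2 * vmin calA calB r).
    by field; rewrite gt_eqF.
  by rewrite ler_pdivrMr ?mulr_gt0 // mulrC -mulrA q_sym_weight_le.
(* The seed of the minimum is the ratio of [calA :|: calB], which obeys the same bound by
   [q_gt0]. *)
by apply: le_bigmin => [|Z /andP[_]]; exact: ratio_ge.
Qed.
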